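(* Let $T\colon E\to F$ be an order bounded linear operator between two Riesz spaces. (1) If $F$ is Archimedean and $T$ is disjointness preserving, then $T^{\sim\sim}\colon E^{\sim\sim}\to F^{\sim\sim}$ is disjointness preserving. (2) If $J_E\colon E\to E^{\sim\sim}$ is a bijection and $T$ is disjointness preserving, then $T^{\sim\sim}\colon E^{\sim\sim}\to F^{\sim\sim}$ is disjointness preserving. (3) If $F^\sim$ separates the points of $F$ and $T^{\sim\sim}\colon E^{\sim\sim}\to F^{\sim\sim}$ is disjointness preserving, then $T$ is disjointness preserving.
   Context: Riesz spaces (vector lattices) are real and are not assumed Archimedean unless stated. For a Riesz space $E$, $E^\sim$ is its order dual (the Riesz space of order bounded linear functionals on $E$), $E^{\sim\sim}=(E^\sim)^\sim$, and $J_E\colon E\to E^{\sim\sim}$, $J_E(x)(x^\sim)=x^\sim(x)$, is the canonical Riesz homomorphism. For an order bounded linear operator $T\colon E\to F$, its order adjoint is $T^\sim\colon F^\sim\to E^\sim$, $T^\sim(y^\sim)=y^\sim\circ T$, and $T^{\sim\sim}=(T^\sim)^\sim$. Vectors $x,y$ of a Riesz space are disjoint, written $x\perp y$, if $|x|\wedge|y|=0$. A linear operator $T\colon E\to F$ between Riesz spaces is disjointness preserving if $T(x)\perp T(y)$ in $F$ whenever $x\perp y$ in $E$. *)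

(* Defs.v *)
From HB Require Import structures.
From mathcomp Require Import all_boot all_order all_algebra.
From mathcomp Require Import boolp classical_sets functions reals.

Set Implicit Arguments.
Unset Strict Implicit.
Unset Printing Implicit Defensive.

Import Order.TTheory GRing.Theory Num.Theory.
Local Open Scope ring_scope.

(* The lattice operations are fields of this structure, not those of mathcomp's
   `latticeType`: Hierarchy Builder allows no structure that joins `lmodType`
   and `latticeType` once `realDomainType` is declared. *)
HB.mixin Record POrderedLmodule_isRiesz (R : realType) E
    of GRing.Lmodule R E & Num.POrderedZmodule E := {
  riesz_lerD : forall z x y : E, x <= y -> x + z <= y + z;
  riesz_scaler_ge0 : forall (a : R) (x : E), 0 <= a -> 0 <= x -> 0 <= a *: x;
  rsup : E -> E -> E;
  rinf : E -> E -> E;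
  rsup_le : forall x y z : E, (rsup x y <= z) = (x <= z) && (y <= z);
  le_rinf : forall x y z : E, (z <= rinf x y) = (z <= x) && (z <= y)
}.

#[short(type="rieszType")]
HB.structure Definition Riesz (R : realType) :=
  { E of POrderedLmodule_isRiesz R E & GRing.Lmodule R E
       & Num.POrderedZmodule E }.

Section RieszDefs.
Context (R : realType).
Implicit Types E F : rieszType R.

Definition rabs E (x : E) : E := rsup x (- x).

Definition disjoint_vec E (x y : E) : Prop := rinf (rabs x) (rabs y) = 0.

Definition disjointness_preserving E F (T : E -> F) : Prop :=
  forall x y : E, disjoint_vec x y -> disjoint_vec (T x) (T y).

Definition archimedean_riesz E : Prop :=
  forall x y : E, 0 <= x -> (forall n : nat, x *+ n <= y) -> x = 0.

Definition order_bounded E F (T : E -> F) : Prop :=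
  forall a b : E, exists c d : F, forall x, a <= x <= b -> c <= T x <= d.

End RieszDefs.

Section RieszTheory.
Context (R : realType) (E : rieszType R).
Implicit Types x y z u v : E.

Lemma rsup_gel x y : x <= rsup x y.
Proof. by have := lexx (rsup x y); rewrite rsup_le => /andP[]. Qed.

Lemma rsup_ger x y : y <= rsup x y.
Proof. by have := lexx (rsup x y); rewrite rsup_le => /andP[]. Qed.

Lemma rinf_lel x y : rinf x y <= x.
Proof. by have := lexx (rinf x y); rewrite le_rinf => /andP[]. Qed.

Lemma rinf_ler x y : rinf x y <= y.
Proof. by have := lexx (rinf x y); rewrite le_rinf => /andP[]. Qed.

Lemma rsupC x y : rsup x y = rsup y x.
Proof. by apply/eqP; rewrite eq_le !rsup_le !rsup_gel !rsup_ger. Qed.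

Lemma riesz_lerD2r z x y : (x + z <= y + z) = (x <= y).
Proof.
apply/idP/idP; last exact: riesz_lerD.
by move=> /(riesz_lerD (- z)); rewrite !addrK.
Qed.

Lemma riesz_lerD2 x y u v : x <= y -> u <= v -> x + u <= y + v.
Proof.
move=> xy uv; apply: (@le_trans _ _ (y + u)); first exact: riesz_lerD.
by rewrite ![y + _]addrC riesz_lerD2r.
Qed.

Lemma riesz_subr_ge0 x y : (0 <= y - x) = (x <= y).
Proof. by rewrite -(riesz_lerD2r x 0) add0r subrK. Qed.

Lemma riesz_lerBDr x y z : (x <= y - z) = (x + z <= y).
Proof. by rewrite -(riesz_lerD2r z) subrK. Qed.

Lemma riesz_lerN2 x y : (- x <= - y) = (y <= x).
Proof. by rewrite -[LHS]riesz_subr_ge0 opprK addrC riesz_subr_ge0. Qed.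

Lemma riesz_lerB2l z x y : (z - x <= z - y) = (y <= x).
Proof. by rewrite ![z - _]addrC riesz_lerD2r riesz_lerN2. Qed.

Lemma riesz_addr_ge0 x y : 0 <= x -> 0 <= y -> 0 <= x + y.
Proof. by move=> x0 y0; rewrite -[0](addr0 0); exact: riesz_lerD2. Qed.

Lemma rsupDr z x y : rsup x y + z = rsup (x + z) (y + z).
Proof.
apply/eqP; rewrite eq_le; apply/andP; split; last first.
  by rewrite rsup_le !riesz_lerD2r rsup_gel rsup_ger.
by rewrite -riesz_lerBDr rsup_le !riesz_lerBDr rsup_gel rsup_ger.
Qed.

Lemma riesz_scaler_le (a : R) x y : 0 <= a -> x <= y -> a *: x <= a *: y.
Proof.
move=> a0; rewrite -riesz_subr_ge0 => /(riesz_scaler_ge0 _ _ a0).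
by rewrite scalerBr riesz_subr_ge0.
Qed.

Lemma scaler_rsupr (a : R) x y :
  0 < a -> a *: rsup x y = rsup (a *: x) (a *: y).
Proof.
move=> a0; have a0' := ltW a0; have an : a != 0 by rewrite gt_eqF.
have ai : 0 <= a^-1 by rewrite invr_ge0.
apply/eqP; rewrite eq_le; apply/andP; split; last first.
  by rewrite rsup_le !riesz_scaler_le ?rsup_gel ?rsup_ger.
rewrite -[leRHS](scalerKV an); apply: riesz_scaler_le => //.
rewrite rsup_le -{1}[x](scalerK an) -{2}[y](scalerK an).
by rewrite !riesz_scaler_le ?rsup_gel ?rsup_ger.
Qed.

Definition rpos x : E := rsup x 0.

Lemma rpos_ge0 x : 0 <= rpos x. Proof. exact: rsup_ger. Qed.
Lemma rpos_ge x : x <= rpos x. Proof. exact: rsup_gel. Qed.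
Hint Resolve rpos_ge0 : core.

Lemma rposBN x : rpos x - rpos (- x) = x.
Proof.
apply/eqP; rewrite subr_eq addrC /rpos rsupDr addNr add0r.
by rewrite rsupC.
Qed.

Lemma rpos_id x : 0 <= x -> rpos x = x.
Proof. by move=> x0; apply/eqP; rewrite eq_le rsup_le lexx x0 rpos_ge. Qed.

Lemma rposD x y : rpos (x + y) <= rpos x + rpos y.
Proof.
by rewrite rsup_le riesz_lerD2 ?rpos_ge //= riesz_addr_ge0.
Qed.

Lemma rposZ (a : R) x : 0 < a -> rpos (a *: x) = a *: rpos x.
Proof. by move=> a0; rewrite /rpos scaler_rsupr // scaler0. Qed.

Lemma riesz_sum_ge0 (s : seq E) :
  all (fun y => 0 <= y) s -> 0 <= \sum_(y <- s) y.
Proof.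
elim: s => [|a s ih] /=; first by rewrite big_nil.
by case/andP=> a0 /ih; rewrite big_cons; exact: riesz_addr_ge0.
Qed.

Lemma riesz_split z x y : 0 <= x -> 0 <= y -> 0 <= z -> z <= x + y ->
  exists z1 z2, [/\ z = z1 + z2, 0 <= z1 <= x & 0 <= z2 <= y].
Proof.
move=> x0 y0 z0 zxy; exists (rinf z x), (z - rinf z x).
split; first by rewrite addrC subrK.
  by rewrite le_rinf z0 x0 rinf_ler.
rewrite riesz_subr_ge0 rinf_lel /=.
have : z - y <= rinf z x.
  rewrite le_rinf; apply/andP; split; rewrite -riesz_subr_ge0 opprB addrCA.
    by rewrite subrr addr0.
  by rewrite addrCA addrA riesz_subr_ge0.
by rewrite -riesz_subr_ge0 opprB addrCA -(opprB z) riesz_subr_ge0.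
Qed.

Lemma riesz_split_seq (s : seq E) x y : all (fun z => 0 <= z) s ->
  0 <= x -> 0 <= y -> \sum_(z <- s) z = x + y ->
  exists t : seq (E * E),
    [/\ s = [seq w.1 + w.2 | w <- t],
        all (fun w => (0 <= w.1) && (0 <= w.2)) t,
        \sum_(w <- t) w.1 = x & \sum_(w <- t) w.2 = y].
Proof.
elim: s x y => [|a s ih] x y /=.
  rewrite big_nil => _ x0 y0 e; exists [::]; rewrite !big_nil; split => //.
  - by apply/eqP; rewrite eq_le x0 /= e -{1}[x]addr0 riesz_lerD2.
  - by apply/eqP; rewrite eq_le y0 /= e -{1}[y]add0r riesz_lerD2.
case/andP=> a0 s0 x0 y0; rewrite big_cons => e.
have axy : a <= x + y by rewrite -e -{1}[a]addr0 riesz_lerD2 // riesz_sum_ge0.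
have [a1 [a2 [ea /andP[a10 a1x] /andP[a20 a2y]]]] := riesz_split x0 y0 a0 axy.
have e' : \sum_(z <- s) z = (x - a1) + (y - a2).
  by apply: (addrI a); rewrite e ea addrACA [a1 + _]addrC [a2 + _]addrC !subrK.
rewrite -riesz_subr_ge0 in a1x; rewrite -riesz_subr_ge0 in a2y.
have [t [-> t0 tx ty]] := ih _ _ s0 a1x a2y e'.
exists ((a1, a2) :: t); split => /=.
- by rewrite ea.
- by rewrite a10 a20.
- by rewrite big_cons tx /= addrC subrK.
- by rewrite big_cons ty /= addrC subrK.
Qed.

End RieszTheory.

Section OrderBoundedOperators.
Context (R : realType) (E F : rieszType R).

Definition obop_pred : {pred E -> F} :=
  fun T => `[< linear T /\ order_bounded T >].

Record obop := OBOp { obop_fun :> E -> F; _ : obop_fun \in obop_pred }.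

HB.instance Definition _ := [isSub for obop_fun].
HB.instance Definition _ := [Choice of obop by <:].

Lemma obop_linear (T : obop) : linear T.
Proof. by case: T => T /= /asboolP[]. Qed.

Lemma obop_bounded (T : obop) : order_bounded T.
Proof. by case: T => T /= /asboolP[]. Qed.

HB.instance Definition _ (T : obop) :=
  GRing.isLinear.Build R E F *:%R (obop_fun T) (obop_linear T).

Lemma obopP (T S : obop) : (forall x, T x = S x) -> T = S.
Proof. by move=> TS; apply/val_inj/funext. Qed.

Lemma obop_mkP (T : E -> F) : linear T -> order_bounded T -> T \in obop_pred.
Proof. by move=> lT bT; apply/asboolP. Qed.

Definition mk_obop (T : E -> F) (lT : linear T) (bT : order_bounded T) : obop :=
  OBOp (obop_mkP lT bT).

Lemma obop_submod_closed : GRing.submod_closed obop_pred.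
Proof.
split.
  apply: obop_mkP => [a x y|a b]; last by exists 0, 0 => x _; rewrite lexx.
  by apply: (@etrans _ _ (a *: (0 : F) + 0)) => //; rewrite scaler0 addr0.
move=> k T S /asboolP[lT bT] /asboolP[lS bS]; apply: obop_mkP.
  move=> a x y; rewrite !fctE lT lS !scalerDr !scalerA [a * k]mulrC.
  by rewrite addrACA.
move=> a b; have [c [d Tcd]] := bT a b; have [c' [d' Scd]] := bS a b.
have [k0|k0] := leP 0 k.
  exists (k *: c + c'), (k *: d + d') => x xab.
  have /andP[cT Td] := Tcd _ xab; have /andP[cS Sd] := Scd _ xab.
  by rewrite !fctE !riesz_lerD2 // riesz_scaler_le.
exists (k *: d + c'), (k *: c + d') => x xab.
have /andP[cT Td] := Tcd _ xab; have /andP[cS Sd] := Scd _ xab.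
have kN (u v : F) : u <= v -> k *: v <= k *: u.
  move=> uv; rewrite -riesz_lerN2 -!scaleNr riesz_scaler_le //.
  by rewrite oppr_ge0 ltW.
by rewrite !fctE !riesz_lerD2 // kN.
Qed.

HB.instance Definition _ :=
  GRing.isSubmodClosed.Build R (E -> F) obop_pred obop_submod_closed.
HB.instance Definition _ := [SubChoice_isSubLmodule of obop by <:].

End OrderBoundedOperators.

Section RegularRiesz.
Context (R : realType).

Lemma regular_lerD (z x y : R^o) : (x : R) <= y -> (x + z : R) <= y + z.
Proof. by rewrite lerD2r. Qed.

Lemma regular_scaler_ge0 (a : R) (x : R^o) :
  0 <= a -> 0 <= (x : R) -> 0 <= (a *: x : R).
Proof. exact: mulr_ge0. Qed.

HB.instance Definition _ := Num.POrderedZmodule.copy R^o R.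

HB.instance Definition _ := POrderedLmodule_isRiesz.Build R R^o
  regular_lerD regular_scaler_ge0
  (fun x y z : R^o => ge_max z x y : (Num.max (x : R) y <= z) = _)
  (fun x y z : R^o => le_min z x y).

End RegularRiesz.

(* Riesz-Kantorovich argument: the least functional majorizing
   x |-> g ((T x)^+) on the positive cone is, at x >= 0, the supremum of
   \sum_i g ((T x_i)^+) over the finite decompositions x = \sum_i x_i with
   x_i >= 0. It gives the suprema in the order dual (T = g2 - g1, g = id) and
   the order boundedness of the order adjoint. *)
Section PositiveMajorant.
Context (R : realType) (E F : rieszType R).
Variables (T : obop E F) (g : {linear F -> R^o}).
Hypothesis g_ge0 : forall z : F, 0 <= z -> 0 <= (g z : R).

Let g_le (z w : F) : z <= w -> (g z : R) <= g w.
Proof. by rewrite -riesz_subr_ge0 => /g_ge0; rewrite linearB subr_ge0. Qed.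

Definition part_sums (x : E) : set R := [set r | exists s : seq E,
  [/\ all (fun y => 0 <= y) s, \sum_(y <- s) y = x
    & r = \sum_(y <- s) (g (rpos (T y)) : R)]]%classic.

Let part_sums_neq0 x : 0 <= x -> (part_sums x !=set0)%classic.
Proof.
move=> x0; exists (g (rpos (T x))), [:: x].
by rewrite /= x0 !big_seq1.
Qed.

Let part_sums_ge0 x r : part_sums x r -> 0 <= r.
Proof. by case=> s [_ _ ->]; apply: sumr_ge0 => y _; exact/g_ge0/rpos_ge0. Qed.

Let part_sums_bounded x : 0 <= x -> has_ubound (part_sums x).
Proof.
move=> x0; have [l [u Tu]] := obop_bounded T 0 x.
exists (g u : R) => _ [s [s0 sx ->]].
rewrite -linear_sum; apply: g_le.
suff H c : 0 <= c -> c + \sum_(y <- s) y <= x ->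
    T c + \sum_(y <- s) rpos (T y) <= u.
  by have := H 0; rewrite linear0 !add0r sx !lexx; apply.
elim: s s0 {sx} c => [|a s ih] /=.
  move=> _ c c0; rewrite !big_nil !addr0 => cx.
  by have := Tu c; rewrite c0 cx => /(_ isT)/andP[].
case/andP=> a0 s0 c c0; rewrite !big_cons => acx.
rewrite addrCA rsupDr add0r rsup_le addrA -linearD ih //.
- apply: ih => //; apply: le_trans acx; rewrite riesz_lerD2 //.
  by rewrite -{1}[\sum_(y <- s) y]add0r riesz_lerD2r.
- exact: riesz_addr_ge0.
- by rewrite -addrA addrCA.
Qed.

Let hsup x : R := sup (part_sums x).

Let hsup_ub x r : 0 <= x -> part_sums x r -> r <= hsup x.
Proof. by move=> x0; exact/ub_le_sup/part_sums_bounded. Qed.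

Let hsup_lub x r : 0 <= x -> (forall t, part_sums x t -> t <= r) -> hsup x <= r.
Proof. by move=> x0; exact/ge_sup/part_sums_neq0. Qed.

Let hsup_ge0 x : 0 <= x -> 0 <= hsup x.
Proof.
move=> x0; have [r pr] := part_sums_neq0 x0.
exact: le_trans (part_sums_ge0 pr) (hsup_ub x0 pr).
Qed.

Let hsupD x y : 0 <= x -> 0 <= y -> hsup (x + y) = hsup x + hsup y.
Proof.
move=> x0 y0; have xy0 := riesz_addr_ge0 x0 y0.
apply/eqP; rewrite eq_le; apply/andP; split.
  apply: hsup_lub => // _ [s [s0 sxy ->]].
  have [t [-> t0 tx ty]] := riesz_split_seq s0 x0 y0 sxy.
  apply: (@le_trans _ _ (\sum_(w <- t) (g (rpos (T w.1)) : R)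
      + \sum_(w <- t) (g (rpos (T w.2)) : R))).
    rewrite -big_split big_map /=; apply: ler_sum => w _.
    by rewrite -[leRHS]linearD g_le // linearD rposD.
  apply: lerD; apply: hsup_ub => //.
    exists [seq w.1 | w <- t]; rewrite !big_map; split => //.
    by rewrite all_map; apply: sub_all t0 => w /= /andP[].
  exists [seq w.2 | w <- t]; rewrite !big_map; split => //.
  by rewrite all_map; apply: sub_all t0 => w /= /andP[].
rewrite -lerBrDr; apply: hsup_lub => // r1 [s1 [s10 s1x r1E]].
rewrite lerBrDr -lerBrDl; apply: hsup_lub => // r2 [s2 [s20 s2y r2E]].
rewrite lerBrDl; apply: hsup_ub => //; exists (s1 ++ s2).
by rewrite all_cat s10 s20 !big_cat /= s1x s2y r1E r2E.
Qed.

Let hsupZ_le (a : R) x : 0 < a -> 0 <= x -> a * hsup x <= hsup (a *: x).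
Proof.
move=> a0 x0; rewrite -ler_pdivlMl //; apply: hsup_lub => // _ [s [s0 sx ->]].
rewrite ler_pdivlMl //; apply: hsup_ub; first exact: riesz_scaler_ge0 (ltW a0) x0.
exists [seq a *: y | y <- s]; split.
- rewrite all_map; apply: sub_all s0 => y /=.
  exact: riesz_scaler_ge0 (ltW a0).
- by rewrite big_map -sx scaler_sumr.
- by rewrite big_map mulr_sumr; apply: eq_bigr => y _; rewrite linearZ rposZ // linearZ.
Qed.

Let hsup0 : hsup 0 = 0.
Proof. by apply: (addrI (hsup 0)); rewrite -hsupD // !addr0. Qed.

Let hsupZ (a : R) x : 0 <= a -> 0 <= x -> hsup (a *: x) = a * hsup x.
Proof.
rewrite le_eqVlt => /orP[/eqP <- _|a0 x0].
  by rewrite scale0r mul0r hsup0.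
apply/eqP; rewrite eq_le hsupZ_le // andbT.
rewrite -ler_pdivrMl // -{2}[x](scalerK (lt0r_neq0 a0)).
by rewrite hsupZ_le ?invr_gt0 // riesz_scaler_ge0 // ltW.
Qed.

Let h x : R^o := hsup (rpos x) - hsup (rpos (- x)).

Let hE u v : 0 <= u -> 0 <= v -> h (u - v) = hsup u - hsup v.
Proof.
move=> u0 v0; apply/eqP; rewrite /h subr_eq addrAC eq_sym subr_eq.
have [p0 n0] := (rpos_ge0 (u - v), rpos_ge0 (- (u - v))).
rewrite -!hsupD //; apply/eqP; congr hsup.
move/eqP: (rposBN (u - v)); rewrite subr_eq => /eqP ->.
by rewrite [RHS]addrAC subrK.
Qed.

Let h_linear : linear h.
Proof.
move=> a x y.
have [px nx] := (rpos_ge0 x, rpos_ge0 (- x)).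
have [py ny] := (rpos_ge0 y, rpos_ge0 (- y)).
rewrite -{1}(rposBN x) -{1}(rposBN y).
have [a0|/ltW a0] := leP 0 a.
  have -> : a *: (rpos x - rpos (- x)) + (rpos y - rpos (- y))
      = (a *: rpos x + rpos y) - (a *: rpos (- x) + rpos (- y)).
    by rewrite scalerBr opprD addrACA.
  have [ax an] := (riesz_scaler_ge0 _ _ a0 px, riesz_scaler_ge0 _ _ a0 nx).
  rewrite hE ?riesz_addr_ge0 // !hsupD // !hsupZ // /h opprD addrACA.
  by rewrite -mulrBr.
have na0 : 0 <= - a by rewrite oppr_ge0.
have -> : a *: (rpos x - rpos (- x)) + (rpos y - rpos (- y))
    = (- a *: rpos (- x) + rpos y) - (- a *: rpos x + rpos (- y)).
  by rewrite scalerBr !scaleNr opprD opprK [RHS]addrACA [- _ + a *: _]addrC.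
have [ax an] := (riesz_scaler_ge0 _ _ na0 px, riesz_scaler_ge0 _ _ na0 nx).
rewrite hE ?riesz_addr_ge0 // !hsupD // !hsupZ // /h opprD addrACA.
by rewrite -mulrBr -[in RHS]opprB scalerN -scaleNr.
Qed.

Let h_pos x : 0 <= x -> h x = hsup x.
Proof. by move=> x0; rewrite -{1}[x]subr0 hE // hsup0 subr0. Qed.

Let h_bounded : order_bounded h.
Proof.
have h_le x y : x <= y -> h x <= h y.
  move=> xy; rewrite -[y](subrK x) -[y - x]scale1r h_linear scale1r.
  rewrite -{1}[h x]add0r; apply: riesz_lerD.
  by rewrite h_pos ?riesz_subr_ge0 // hsup_ge0 // riesz_subr_ge0.
by move=> a b; exists (h a), (h b) => x /andP[ax xb]; rewrite !h_le.
Qed.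

Lemma positive_majorant : exists h : obop E R^o,
  (forall x, 0 <= x -> (g (rpos (T x)) : R) <= h x) /\
  (forall k : obop E R^o,
     (forall x, 0 <= x -> (g (rpos (T x)) : R) <= k x) ->
     forall x, 0 <= x -> (h x : R) <= k x).
Proof.
exists (mk_obop h_linear h_bounded); split => [x x0|k gk x x0] /=.
  rewrite h_pos //; apply: hsup_ub => //; exists [:: x].
  by rewrite /= x0 !big_seq1.
rewrite h_pos //; apply: hsup_lub => // _ [s [s0 <- ->]].
rewrite linear_sum /=; elim: s s0 => [|y s ih] /=; first by rewrite !big_nil.
by case/andP=> y0 /ih; rewrite !big_cons; apply: lerD; exact: gk.
Qed.

End PositiveMajorant.

Section OrderDual.
Context (R : realType) (E : rieszType R).

Definition odual : Type := obop E R^o.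

HB.instance Definition _ := GRing.Lmodule.on odual.

Implicit Types f g h k : odual.

Definition odual_le f g : bool :=
  `[< forall x : E, 0 <= x -> (f x : R) <= g x >].

Let odual_leP f g :
  reflect (forall x : E, 0 <= x -> (f x : R) <= g x) (odual_le f g).
Proof. exact: asboolP. Qed.

Let odual_le_refl : reflexive odual_le.
Proof. by move=> f; apply/odual_leP. Qed.

Let odual_le_anti : antisymmetric odual_le.
Proof.
move=> f g /andP[/odual_leP fg /odual_leP gf]; apply: obopP => x.
have fgE y : 0 <= y -> f y = g y.
  by move=> y0; apply: le_anti; rewrite fg ?gf.
by rewrite -(rposBN x) !linearB /= !fgE ?rpos_ge0.
Qed.

Let odual_le_trans : transitive odual_le.
Proof.
move=> g f h /odual_leP fg /odual_leP gh; apply/odual_leP => x x0.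
exact: le_trans (fg x x0) (gh x x0).
Qed.

HB.instance Definition _ := Order.Le_isPOrder.Build ring_display odual
  odual_le_refl odual_le_anti odual_le_trans.

Lemma odual_lerP f g :
  reflect (forall x : E, 0 <= x -> (f x : R) <= g x) (f <= g).
Proof. exact: odual_leP. Qed.

Lemma odualDE f g x : (f + g) x = f x + g x :> R. Proof. by []. Qed.
Lemma odualNE f x : (- f) x = - f x :> R. Proof. by []. Qed.
Lemma odualZE (a : R) f x : (a *: f) x = a * f x :> R. Proof. by []. Qed.
Lemma odual0E x : (0 : odual) x = 0 :> R. Proof. by []. Qed.

Lemma odual_lerD h f g : f <= g -> f + h <= g + h.
Proof.
move=> /odual_lerP fg; apply/odual_lerP => x x0.
by rewrite !odualDE lerD2r fg.
Qed.

Lemma odual_scaler_ge0 (a : R) f : 0 <= a -> 0 <= f -> 0 <= a *: f.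
Proof.
move=> a0 /odual_lerP f0; apply/odual_lerP => x x0.
by rewrite odualZE mulr_ge0 //; exact: f0.
Qed.

Lemma odual_sup_exists f g : exists h, forall k, (h <= k) = (f <= k) && (g <= k).
Proof.
pose i : {linear R^o -> R^o} := idfun.
have [//|h [hge hle]] := @positive_majorant R E R^o (g - f) i.
exists (f + h) => k; apply/idP/andP => [/odual_lerP fhk|[/odual_lerP fk /odual_lerP gk]].
  split; apply/odual_lerP => x x0; apply: le_trans (fhk x x0); rewrite odualDE.
    rewrite lerDl; apply: le_trans (hge x x0); exact: (@rpos_ge0 R R^o).
  rewrite -lerBlDl; apply: le_trans (hge x x0).
  exact: (@rpos_ge R R^o ((g - f : odual) x)).
apply/odual_lerP => x x0; rewrite odualDE -lerBrDl.
have := hle (k - f); apply => // y y0.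
change ((rpos ((g - f) y : R^o) : R^o) <= (k - f) y).
rewrite rsup_le; apply/andP; split.
  by change ((g y - f y : R) <= k y - f y); rewrite lerD2r gk.
by change ((0 : R) <= k y - f y); rewrite subr_ge0 fk.
Qed.

Definition odual_sup f g : odual := sval (cid (odual_sup_exists f g)).
Definition odual_inf f g : odual := - odual_sup (- f) (- g).

Lemma odual_sup_le f g k : (odual_sup f g <= k) = (f <= k) && (g <= k).
Proof. exact: (svalP (cid (odual_sup_exists f g))). Qed.

Lemma odual_lerN2 f g : (- f <= - g) = (g <= f).
Proof.
by apply/odual_lerP/odual_lerP => fg x /fg; rewrite !odualNE lerN2.
Qed.

Lemma odual_le_inf f g k : (k <= odual_inf f g) = (k <= f) && (k <= g).
Proof. by rewrite -{1}[k]opprK odual_lerN2 odual_sup_le !odual_lerN2. Qed.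

HB.instance Definition _ := POrderedLmodule_isRiesz.Build R odual
  odual_lerD odual_scaler_ge0 odual_sup_le odual_le_inf.

End OrderDual.

Section Adjoint.
Context (R : realType) (E F : rieszType R) (T : obop E F).

Lemma oadjoint_in (y : odual F) : (fun x => y (T x)) \in @obop_pred R E R^o.
Proof.
apply: obop_mkP => [a u v|a b]; first by rewrite !linearP.
have [c [d Tcd]] := obop_bounded T a b.
have [l [u ylu]] := obop_bounded y c d.
by exists l, u => x /Tcd/ylu.
Qed.

Definition oadjoint_fun (y : odual F) : odual E := OBOp (oadjoint_in y).

Lemma oadjoint_funE y x : oadjoint_fun y x = y (T x). Proof. by []. Qed.

Lemma oadjoint_linear : linear oadjoint_fun.
Proof. by move=> a y z; apply: obopP. Qed.

Lemma oadjoint_bounded : order_bounded oadjoint_fun.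
Proof.
move=> a b; have [ab|nab] := boolP (a <= b); last first.
  exists 0, 0 => y /andP[ay yb]; by rewrite (le_trans ay yb) in nab.
have g0 (z : F) : 0 <= z -> 0 <= ((b - a) z : R).
  by move=> z0; rewrite odualDE odualNE subr_ge0; move/odual_lerP: ab; apply.
have [h [hge _]] := positive_majorant T g0.
have dom (y : odual F) : 0 <= y -> y <= b - a -> oadjoint_fun y <= h.
  move=> /odual_lerP y0 /odual_lerP yba; apply/odual_lerP => x x0.
  apply: le_trans (hge x x0); apply: le_trans (yba _ (rpos_ge0 _)).
  rewrite oadjoint_funE -subr_ge0 -[_ - _](linearB y).
  apply: y0; rewrite riesz_subr_ge0; exact: rpos_ge.
have adjB (y z : odual F) :
    oadjoint_fun (y - z) = oadjoint_fun y - oadjoint_fun z.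
  exact: obopP.
exists (oadjoint_fun b - h), (oadjoint_fun a + h) => y /andP[ay yb].
apply/andP; split.
  rewrite -riesz_subr_ge0 opprB addrCA -(opprB (oadjoint_fun b)).
  by rewrite riesz_subr_ge0 -adjB dom ?riesz_subr_ge0 ?riesz_lerB2l.
rewrite addrC -[leLHS](subrK (oadjoint_fun a)) riesz_lerD2r -adjB.
by rewrite dom ?riesz_subr_ge0 ?riesz_lerD2r.
Qed.

Definition oadjoint : obop (odual F) (odual E) :=
  mk_obop oadjoint_linear oadjoint_bounded.

Lemma oadjointE (y : odual F) (x : E) : oadjoint y x = y (T x).
Proof. by []. Qed.

End Adjoint.

Section Bidual.
Context (R : realType) (E : rieszType R).

Lemma eval_in (x : E) :
  (fun f : odual E => f x) \in @obop_pred R (odual E) R^o.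
Proof.
apply: obop_mkP => // f g.
exists (f (rpos x) - g (rpos (- x))), (g (rpos x) - f (rpos (- x))).
move=> h /andP[/odual_lerP fh /odual_lerP hg].
have -> : h x = h (rpos x) - h (rpos (- x)).
  by rewrite -[LHS]/(h x) -{1}(rposBN x) linearB.
have [p0 n0] := (rpos_ge0 x, rpos_ge0 (- x)).
apply/andP; split; first exact: (lerB (fh _ p0) (hg _ n0)).
exact: (lerB (hg _ p0) (fh _ n0)).
Qed.

Definition bidual_eval (x : E) : odual (odual E) := OBOp (eval_in x).

Lemma bidual_evalE (x : E) (f : odual E) : bidual_eval x f = f x.
Proof. by []. Qed.

Definition odual_separates_points : Prop :=
  forall x y : E, x <> y -> exists f : odual E, f x <> f y.

End Bidual.

(* Main.v *)
(* Let [S x = |T x|] on the positive cone. When [F] is Archimedean, [T x] and [T y]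
   have no opposite signs for [x, y >= 0] (Meyer), so [S] is additive and extends
   to a Riesz homomorphism, with [|T'' A| <= S'' |A|] on the bidual. By
   Hahn-Banach every [g] in [[0, S' phi]] is some [S' psi] with [0 <= psi <= phi];
   together with the Riesz-Kantorovich formula for [A /\ B] this makes [S''] preserve
   disjointness, hence also [T'']. Parts (2) and (3) hold because [J] is a Riesz
   homomorphism and [T'' J_E = J_F T]. *)
Require Import Defs.
From HB Require Import structures.
From mathcomp Require Import all_boot all_order all_algebra.
From mathcomp Require Import boolp classical_sets functions reals.
From mathcomp Require Import lra.

Set Implicit Arguments.
Unset Strict Implicit.
Unset Printing Implicit Defensive.

Import Order.TTheory GRing.Theory Num.Theory.
Local Open Scope ring_scope.

(** * Disjointness, positive parts and moduli in a Riesz space *)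

Section RieszFacts.
Context (R : realType) (E : rieszType R).
Implicit Types x y z u v w d p q : E.

Lemma riesz_lerBlDr x y z : (x - z <= y) = (x <= y + z).
Proof. by rewrite -(riesz_lerD2r z (x - z)) subrK. Qed.

Lemma riesz_lerDl x y : (x <= x + y) = (0 <= y).
Proof. by rewrite -riesz_subr_ge0 addrAC subrr add0r. Qed.

Lemma riesz_lerDr x y : (x <= y + x) = (0 <= y).
Proof. by rewrite addrC riesz_lerDl. Qed.

Lemma riesz_lerMn2 x y n : 0 <= x -> x <= y -> x *+ n <= y *+ n.
Proof. by move=> x0 xy; rewrite -!scaler_nat riesz_scaler_le // ler0n. Qed.

Lemma riesz_mulrn_ge0 x n : 0 <= x -> 0 <= x *+ n.
Proof. by move=> x0; rewrite -scaler_nat riesz_scaler_ge0 // ler0n. Qed.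

Lemma rinfC x y : rinf x y = rinf y x.
Proof. by apply/eqP; rewrite eq_le !le_rinf !rinf_lel !rinf_ler. Qed.

Lemma rinf_ge0 x y : 0 <= x -> 0 <= y -> 0 <= rinf x y.
Proof. by move=> x0 y0; rewrite le_rinf x0. Qed.

Lemma rinf_eq0_le u v z : rinf u v = 0 -> z <= u -> z <= v -> z <= 0.
Proof. by move=> <- zu zv; rewrite le_rinf zu. Qed.

Lemma rinf_eq0 u v : 0 <= u -> 0 <= v ->
  (forall z, 0 <= z -> z <= u -> z <= v -> z <= 0) -> rinf u v = 0.
Proof.
move=> u0 v0 H; apply/eqP; rewrite eq_le rinf_ge0 // H ?rinf_lel ?rinf_ler //.
exact: rinf_ge0.
Qed.

Lemma rinf_eq0S u v u' v' : rinf u v = 0 ->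
  0 <= u' -> u' <= u -> 0 <= v' -> v' <= v -> rinf u' v' = 0.
Proof.
move=> uv u0 uu v0 vv; apply: rinf_eq0 => // z _ zu zv.
by apply: (rinf_eq0_le uv); [exact: le_trans uu | exact: le_trans vv].
Qed.

(** Riesz decomposition splits [d] into pieces below [p] and [q]; the second lies below both [d] and
    [q], so it is at most 0. This is the tool for cancelling a disjoint summand. *)
Lemma rinf_eq0_lerD d p q : 0 <= d -> 0 <= p -> 0 <= q ->
  rinf d q = 0 -> d <= p + q -> d <= p.
Proof.
move=> d0 p0 q0 dq dpq.
have [d1 [d2 [dE /andP[d10 d1p] /andP[_ d2q]]]] := riesz_split p0 q0 d0 dpq.
have d2_le0 : d2 <= 0 by apply: (rinf_eq0_le dq); rewrite // dE riesz_lerDr.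
by apply: le_trans d1p; rewrite dE -{2}[d1]addr0 riesz_lerD2.
Qed.

Lemma rinf_eq0D u v w : 0 <= u -> 0 <= v -> 0 <= w ->
  rinf u w = 0 -> rinf v w = 0 -> rinf (u + v) w = 0.
Proof.
move=> u0 v0 w0 uw vw; apply: rinf_eq0 => //; first exact: riesz_addr_ge0.
move=> z z0 zuv zw; apply: (rinf_eq0_le uw) => //.
apply: (rinf_eq0_lerD z0 u0 v0) => //; rewrite rinfC.
exact: (rinf_eq0S vw).
Qed.

Lemma rinf_eq0Mn u v n : 0 <= u -> 0 <= v ->
  rinf u v = 0 -> rinf (u *+ n) v = 0.
Proof.
move=> u0 v0 uv; elim: n => [|n ih].
  by rewrite mulr0n; apply: rinf_eq0 => // z _.
by rewrite mulrS rinf_eq0D // riesz_mulrn_ge0.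
Qed.

Lemma addr_rposN x : x + rpos (- x) = rpos x.
Proof. by rewrite -{1}[x]rposBN subrK. Qed.

(** For a common lower bound [z] of the two parts, [rpos x - z] still bounds [x] and 0 from above,
    so leastness of [rpos x] forces [z <= 0]. *)
Lemma rpos_disj x : rinf (rpos x) (rpos (- x)) = 0.
Proof.
apply: rinf_eq0; rewrite ?rpos_ge0 // => z _ zp zn.
have : rpos x <= rpos x - z.
  rewrite {1}/rpos rsup_le riesz_subr_ge0 zp andbT.
  by rewrite -{1}[x]rposBN riesz_lerB2l.
by rewrite riesz_lerDl -{1}oppr0 riesz_lerN2.
Qed.

Lemma rsup_disj p q : rinf p q = 0 -> 0 <= p -> 0 <= q ->
  forall r, p <= r -> q <= r -> p + q <= r.
Proof.
move=> pq p0 q0 r pr qr; rewrite -riesz_lerBDr.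
by apply: (@rinf_eq0_lerD p _ q); rewrite ?riesz_subr_ge0 // subrK.
Qed.

Lemma rabs_ge0 x : 0 <= rabs x.
Proof.
have : 0 <= rabs x *+ 2.
  by rewrite mulr2n -{1}(subrr x) riesz_lerD2 ?rsup_gel ?rsup_ger.
have half_ge0 : (0 : R) <= 2%:R^-1 by rewrite invr_ge0 ler0n.
rewrite -scaler_nat => /(riesz_scaler_ge0 _ _ half_ge0).
by rewrite scalerK // pnatr_eq0.
Qed.

Lemma rabs_le x y : (rabs x <= y) = (x <= y) && (- x <= y).
Proof. exact: rsup_le. Qed.

Lemma rabsN x : rabs (- x) = rabs x.
Proof. by rewrite /rabs opprK rsupC. Qed.

Lemma rabs_id x : 0 <= x -> rabs x = x.
Proof.
move=> x0; apply/eqP; rewrite eq_le rabs_le lexx rsup_gel andbT /=.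
by apply: le_trans (x0); rewrite -oppr0 riesz_lerN2.
Qed.

Lemma rabsD x y : rabs (x + y) <= rabs x + rabs y.
Proof. by rewrite rabs_le opprD !riesz_lerD2 ?rsup_gel ?rsup_ger. Qed.

Lemma rabsZ (a : R) x : 0 <= a -> rabs (a *: x) = a *: rabs x.
Proof.
rewrite le_eqVlt => /orP[/eqP <-|a0].
  by rewrite !scale0r rabs_id.
by rewrite /rabs scaler_rsupr // scalerN.
Qed.

Lemma rabs_disjB p q : rinf p q = 0 -> 0 <= p -> 0 <= q ->
  rabs (p - q) = p + q.
Proof.
move=> pq p0 q0; apply/eqP; rewrite eq_le; apply/andP; split.
  by apply: le_trans (rabsD _ _) _; rewrite rabsN !rabs_id.
apply: rsup_disj => //.
  apply: (@rinf_eq0_lerD p _ q) => //; first exact: rabs_ge0.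
  by rewrite -riesz_lerBlDr rsup_gel.
apply: (@rinf_eq0_lerD q _ p) => //; [exact: rabs_ge0|by rewrite rinfC|].
by rewrite -riesz_lerBlDr -(opprB p) rsup_ger.
Qed.

Lemma rabsE x : rabs x = rpos x + rpos (- x).
Proof.
by rewrite -{1}[x]rposBN rabs_disjB ?rpos_ge0 // rpos_disj.
Qed.

Lemma rpos_disjB p q : rinf p q = 0 -> 0 <= p -> 0 <= q -> rpos (p - q) = p.
Proof.
move=> pq p0 q0; apply/eqP; rewrite eq_le; apply/andP; split.
  by rewrite rsup_le p0 riesz_lerBlDr riesz_lerDl q0.
apply: (@rinf_eq0_lerD p _ q); rewrite ?rpos_ge0 //.
by rewrite -riesz_lerBlDr rpos_ge.
Qed.

Lemma rpos_le x y : x <= y -> rpos x <= rpos y.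
Proof.
move=> xy; rewrite rsup_le rpos_ge0 andbT; exact: le_trans (rpos_ge y).
Qed.

Lemma disjoint_vec_pos p q : 0 <= p -> 0 <= q ->
  disjoint_vec p q <-> rinf p q = 0.
Proof. by move=> p0 q0; rewrite /disjoint_vec !rabs_id. Qed.

End RieszFacts.

(** * Extension of additive maps from the positive cone *)

Section ConeExtension.
Context (R : realType) (E F : rieszType R) (q : E -> F).
Hypothesis q_ge0 : forall x, 0 <= x -> 0 <= q x.
Hypothesis qD : forall x y, 0 <= x -> 0 <= y -> q (x + y) = q x + q y.
Hypothesis qZ : forall (a : R) x, 0 < a -> 0 <= x -> q (a *: x) = a *: q x.

Let h x := q (rpos x) - q (rpos (- x)).

(** Makes [h] independent of the representation: equal differences rearrange to equal sums of
    positive elements, where [q] is additive. *)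
Let hE u v : 0 <= u -> 0 <= v -> h (u - v) = q u - q v.
Proof.
move=> u0 v0; apply/eqP; rewrite /h subr_eq addrAC eq_sym subr_eq.
have [p0 n0] := (rpos_ge0 (u - v), rpos_ge0 (- (u - v))).
rewrite -!qD //; apply/eqP; congr q.
move/eqP: (rposBN (u - v)); rewrite subr_eq => /eqP ->.
by rewrite [RHS]addrAC subrK.
Qed.

Let hD x y : h (x + y) = h x + h y.
Proof.
have [px nx] := (rpos_ge0 x, rpos_ge0 (- x)).
have [py ny] := (rpos_ge0 y, rpos_ge0 (- y)).
rewrite -{1}(rposBN x) -{1}(rposBN y) addrACA -opprD hE ?riesz_addr_ge0 //.
by rewrite !qD // opprD addrACA.
Qed.

Let q0 : q 0 = 0.
Proof. by apply: (addrI (q 0)); rewrite -qD // !addr0. Qed.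

Let hN x : h (- x) = - h x.
Proof. by rewrite /h opprK opprB. Qed.

Let hpos x : 0 <= x -> h x = q x.
Proof. by move=> x0; rewrite -{1}[x]subr0 hE // q0 subr0. Qed.

Let hZpos (a : R) x : 0 < a -> h (a *: x) = a *: h x.
Proof. by move=> a0; rewrite /h -scalerN !rposZ // !qZ ?rpos_ge0 // scalerBr. Qed.

Let h_linear : linear h.
Proof.
move=> a x y; rewrite hD; congr (_ + _).
have [a0|a0|<-] := ltgtP 0 a; first exact: hZpos.
  by rewrite -[a *: x]opprK -scaleNr hN hZpos ?oppr_gt0 // scaleNr opprK.
by rewrite !scale0r hpos.
Qed.

Let h_bounded : order_bounded h.
Proof.
have h_le x y : x <= y -> h x <= h y.
  move=> xy; rewrite -[y](subrK x) hD riesz_lerDr hpos ?riesz_subr_ge0 //.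
  by rewrite q_ge0 // riesz_subr_ge0.
by move=> a b; exists (h a), (h b) => x /andP[ax xb]; rewrite !h_le.
Qed.

Lemma cone_extension : exists S : obop E F, forall x, 0 <= x -> S x = q x.
Proof. by exists (mk_obop h_linear h_bounded). Qed.

End ConeExtension.

(** * Positive operators that preserve disjointness *)

Section PositiveOperators.
Context (R : realType) (E F : rieszType R) (S : {linear E -> F}).
Hypothesis S_ge0 : forall x, 0 <= x -> 0 <= S x.

Lemma pos_op_le x y : x <= y -> S x <= S y.
Proof.
by move=> xy; rewrite -riesz_subr_ge0 -linearB S_ge0 // riesz_subr_ge0.
Qed.

Hypothesis S_disj : forall x y, 0 <= x -> 0 <= y -> rinf x y = 0 ->
  rinf (S x) (S y) = 0.

(** [S (rpos x)] and [S (rpos (- x))] are positive, disjoint and differ by [S x], which identifies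
    them as the two parts of [S x]. *)
Lemma riesz_hom_rpos x : S (rpos x) = rpos (S x).
Proof.
rewrite -{2}[x]rposBN linearB rpos_disjB ?S_ge0 ?rpos_ge0 //.
by apply: S_disj; rewrite ?rpos_ge0 // rpos_disj.
Qed.

Lemma riesz_hom_rabs x : S (rabs x) = rabs (S x).
Proof.
by rewrite !rabsE linearD !riesz_hom_rpos linearN.
Qed.

End PositiveOperators.

(** * Meyer's theorem on disjointness preserving operators *)

Section Meyer.
Context (R : realType) (E F : rieszType R) (T : obop E F).

Lemma obop_rabs_bounded w : exists M, forall z, 0 <= z <= w -> rabs (T z) <= M.
Proof.
have [l [m Tlm]] := obop_bounded T 0 w; exists (rabs l + rabs m) => z /Tlm.
case/andP=> lTz Tzm; rewrite rabs_le; apply/andP; split.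
  apply: le_trans Tzm _; apply: le_trans (rsup_gel m (- m)) _.
  by rewrite riesz_lerDr rabs_ge0.
apply: (@le_trans _ _ (- l)); first by rewrite riesz_lerN2.
apply: le_trans (rsup_ger l (- l)) _.
by rewrite riesz_lerDl rabs_ge0.
Qed.

Hypothesis F_arch : archimedean_riesz F.
Hypothesis T_disj : disjointness_preserving T.

Let T_parts_disj u : rinf (rabs (T (rpos u))) (rabs (T (rpos (- u)))) = 0.
Proof.
apply: T_disj; apply/disjoint_vec_pos; rewrite ?rpos_ge0 //.
exact: rpos_disj.
Qed.

Let T_rabs_parts u : rabs (T u) <= rabs (T (rpos u)) + rabs (T (rpos (- u))).
Proof.
rewrite -{1}[u]rposBN linearB -[rabs (T (rpos (- u)))]rabsN; exact: rabsD.
Qed.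

Section OppositeSigns.
Variables (x y : E) (M : F) (n : nat).
Hypotheses (x_ge0 : 0 <= x) (y_ge0 : 0 <= y) (n_gt0 : (0 < n)%N).
Hypothesis T_le : forall z, 0 <= z <= x + y -> rabs (T z) <= M.

(** [c] measures how far [T x] and [T y] have opposite signs, and [d] is the excess of [c *+ n] over
    [M]. The vectors [u k] descend from [x *+ n] in steps of [y]; [a k] and [b k] come from the two
    parts of [u k] and are disjoint. *)
Let c := rinf (rpos (T x)) (rpos (- T y)).
Let d := rpos (c *+ n - M).
Let u k := x *+ n - y *+ k.
Let a k := rabs (T (rpos (u k))).
Let b k := rabs (T (rpos (- u k))).

Let c_ge0 : 0 <= c. Proof. by rewrite rinf_ge0 // rpos_ge0. Qed.
Let d_ge0 : 0 <= d. Proof. exact: rpos_ge0. Qed.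
Let a_ge0 k : 0 <= a k. Proof. exact: rabs_ge0. Qed.
Let b_ge0 k : 0 <= b k. Proof. exact: rabs_ge0. Qed.

(** Where [c] lives, [T x] and [- T y] are at least [c], so [T (u k)] is at least [c *+ (n + k)].
    The contributions of wrong sign are collected in [e], which is disjoint from [c] and cancels. *)
Let c_le k : c *+ (n + k) <= a k + b k.
Proof.
apply: le_trans (T_rabs_parts (u k)).
pose e := rpos (- T x) *+ n + rpos (T y) *+ k.
have xn_ge0 := riesz_mulrn_ge0 n (rpos_ge0 (- T x)).
have yk_ge0 := riesz_mulrn_ge0 k (rpos_ge0 (T y)).
have ce : rinf c e = 0.
  rewrite rinfC; apply: rinf_eq0D => //; apply: rinf_eq0Mn; rewrite ?rpos_ge0 //.
    rewrite rinfC; apply: (rinf_eq0S (rpos_disj (T x))); rewrite ?rpos_ge0 //.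
    exact: rinf_lel.
  apply: (rinf_eq0S (rpos_disj (T y))); rewrite ?rpos_ge0 //.
  exact: rinf_ler.
have e_ge0 : 0 <= e by exact: riesz_addr_ge0.
apply: (@rinf_eq0_lerD _ _ _ _ e); rewrite ?rabs_ge0 ?riesz_mulrn_ge0 //.
  exact: rinf_eq0Mn.
apply: (@le_trans _ _ (T (u k) + e)); last first.
  by rewrite riesz_lerD2r rsup_gel.
have -> : T (u k) + e = rpos (T x) *+ n + rpos (- T y) *+ k.
  rewrite /u /e linearB /= !(linearMn T) addrACA -mulrnDl -mulNrn -mulrnDl.
  have := addr_rposN (- T y); rewrite opprK => ->.
  by rewrite addr_rposN.
rewrite mulrnDr riesz_lerD2 // riesz_lerMn2 //; [exact: rinf_lel|exact: rinf_ler].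
Qed.

(** The positive parts of [u k] and [u k.+1] differ by an element of [[0, y]], whose image has
    modulus at most [M]. *)
Let a_leS k : a k <= a k.+1 + M.
Proof.
have uS : u k = u k.+1 + y by rewrite /u mulrSr opprD addrA subrK.
have zE : rpos (u k) = rpos (u k.+1) + (rpos (u k) - rpos (u k.+1)).
  by rewrite addrC subrK.
rewrite /a zE linearD; apply: le_trans (rabsD _ _) _.
rewrite addrC [leRHS]addrC riesz_lerD2r; apply: T_le.
rewrite riesz_subr_ge0 rpos_le ?uS ?riesz_lerDl //=.
rewrite riesz_lerBlDr; apply: le_trans (rposD _ _) _.
by rewrite addrC (rpos_id y_ge0) riesz_lerD2r riesz_lerDr.
Qed.

(** As [rpos (u k) <= x *+ n], dividing by [n] brings it into [[0, x]], where [M] bounds the modulus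
    of the image. *)
Let a_le k : a k <= M *+ n.
Proof.
have n0 : (n%:R : R) != 0 by rewrite pnatr_eq0 -lt0n.
have ni0 : (0 : R) <= n%:R^-1 by rewrite invr_ge0 ler0n.
rewrite /a -[rpos (u k)](scalerKV n0) linearZ rabsZ ?ler0n //.
rewrite -[leRHS]scaler_nat riesz_scaler_le ?ler0n //; apply: T_le.
rewrite riesz_scaler_ge0 ?rpos_ge0 //=.
apply: (@le_trans _ _ x); last by rewrite riesz_lerDl.
rewrite -[leRHS](scalerK n0) riesz_scaler_le // scaler_nat.
rewrite rsup_le riesz_mulrn_ge0 // andbT riesz_lerBlDr riesz_lerDl.
exact: riesz_mulrn_ge0.
Qed.

(* By induction on [k]: where [d] lives, [b k] vanishes, hence
   [a k >= c *+ n > M], hence [a k.+1] does not vanish, hence [b k.+1] does. *)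
Let d_disj k : rinf d (b k) = 0.
Proof.
elim: k => [|k ih].
  have -> : b 0 = 0.
    rewrite /b /u mulr0n subr0 (_ : rpos _ = 0) ?linear0 ?rabs_id //.
    apply/eqP; rewrite eq_le rpos_ge0 andbT rsup_le lexx andbT.
    by rewrite -[leRHS]oppr0 riesz_lerN2 riesz_mulrn_ge0.
  by apply: rinf_eq0 => // z _.
apply: (rinf_eq0S (T_parts_disj (u k.+1))) => //.
apply: (@le_trans _ _ (rpos (a k - M))); last first.
  by rewrite rsup_le a_ge0 andbT riesz_lerBlDr a_leS.
apply: (@rinf_eq0_lerD _ _ d _ (b k)) => //; first exact: rpos_ge0.
rewrite rsup_le riesz_addr_ge0 ?rpos_ge0 // andbT.
apply: (@le_trans _ _ (a k - M + b k)); last by rewrite riesz_lerD2r rpos_ge.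
rewrite addrAC riesz_lerD2r; apply: le_trans (c_le k).
by rewrite mulrnDr riesz_lerDl riesz_mulrn_ge0.
Qed.

Lemma opposite_signs_le : c *+ n <= M.
Proof.
suff d_le0 : d <= 0.
  by rewrite -[M]add0r -riesz_lerBlDr; apply: le_trans d_le0; exact: rpos_ge.
(* At [k = n * n] the bound [c *+ (n * n) <= a k + b k <= M *+ n + b k] gives [d <= d *+ n <= b k],
   while [d] is disjoint from [b k]. *)
apply: (rinf_eq0_le (d_disj (n * n))) => //.
apply: (@le_trans _ _ (d *+ n)).
  by rewrite -(prednK n_gt0) mulrS riesz_lerDl riesz_mulrn_ge0.
rewrite -scaler_nat -rposZ ?ltr0n // scaler_nat mulrnBl -mulrnA.
rewrite rsup_le b_ge0 andbT riesz_lerBlDr addrC.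
apply: (@le_trans _ _ (a (n * n) + b (n * n))); last by rewrite riesz_lerD2r.
apply: le_trans (c_le (n * n)).
by rewrite mulrnDr riesz_lerDr riesz_mulrn_ge0.
Qed.

End OppositeSigns.

(** [M] does not depend on [n], so the Archimedean property kills the infimum. *)
Lemma disjointness_preserving_signs x y : 0 <= x -> 0 <= y ->
  rinf (rpos (T x)) (rpos (- T y)) = 0.
Proof.
move=> x0 y0; have [M TM] := obop_rabs_bounded (x + y).
apply: (F_arch (y := M)); first by rewrite rinf_ge0 // rpos_ge0.
case=> [|n]; last exact: (opposite_signs_le x0 y0).
rewrite mulr0n; apply: le_trans (TM 0 _); first exact: rabs_ge0.
by rewrite lexx riesz_addr_ge0.
Qed.

(** Each positive part of [T x] and [T y] is disjoint from each negative part, so adding the parts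
    yields a disjoint decomposition of [T x + T y]. *)
Lemma disjointness_preserving_rabsD x y : 0 <= x -> 0 <= y ->
  rabs (T (x + y)) = rabs (T x) + rabs (T y).
Proof.
move=> x0 y0; rewrite linearD /= -{1}[T x]rposBN -{1}[T y]rposBN addrACA -opprD.
rewrite rabs_disjB ?riesz_addr_ge0 ?rpos_ge0 //; last first.
  apply: rinf_eq0D; rewrite ?riesz_addr_ge0 ?rpos_ge0 // rinfC;
    apply: rinf_eq0D; rewrite ?riesz_addr_ge0 ?rpos_ge0 // rinfC;
    exact: disjointness_preserving_signs.
by rewrite addrACA -!rabsE.
Qed.

(* Meyer's theorem, for the modulus of [T]. *)
Lemma disjointness_preserving_modulus : exists S : obop E F,
  forall x, 0 <= x -> S x = rabs (T x).
Proof.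
apply: cone_extension => [x _|x y|a x a0 _]; first exact: rabs_ge0.
  exact: disjointness_preserving_rabsD.
by rewrite linearZ rabsZ // ltW.
Qed.

End Meyer.

(** * Sublinear functionals and the Hahn-Banach theorem *)

Section Sublinear.
Context (R : realType) (V : lmodType R).
Implicit Types (p q : V -> R) (x y : V).

(** Homogeneity is an inequality for [a > 0], the form easiest to check for infima; applying it to
    the inverse scalar gives equality. *)
Definition sublinear p :=
  (forall x y, p (x + y) <= p x + p y) /\
  (forall (a : R) x, 0 < a -> p (a *: x) <= a * p x).

Lemma sublinearZ p (a : R) x : sublinear p -> 0 <= a -> p (a *: x) = a * p x.
Proof.
case=> pD pZ; have pZ' b z : 0 < b -> p (b *: z) = b * p z.
  move=> b0; apply/eqP; rewrite eq_le pZ //= -ler_pdivlMl //.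
  by rewrite -{1}[z](scalerK (lt0r_neq0 b0)) pZ // invr_gt0.
rewrite le_eqVlt => /orP[/eqP <-|]; last exact: pZ'.
have := pZ' 2 0 (ltr0Sn _ _); rewrite scaler0 scale0r mul0r; lra.
Qed.

Lemma sublinear0 p : sublinear p -> p 0 = 0.
Proof. by move=> ps; rewrite -(scale0r 0) sublinearZ // mul0r. Qed.

Lemma sublinear_geN p x : sublinear p -> - p (- x) <= p x.
Proof.
move=> ps; have := ps.1 x (- x); rewrite subrr sublinear0 //; lra.
Qed.

(** Serves for tilts, for lower bounds of chains, and for lifting functionals through an adjoint. *)
Lemma inf_sublinear (I : Type) (D : set I) (F : I -> V -> R) :
  (D !=set0)%classic ->
  (forall x, exists m, forall i, D i -> m <= F i x) ->
  (forall i j x y, D i -> D j ->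
     exists2 k, D k & F k (x + y) <= F i x + F j y) ->
  (forall i (a : R) x, D i -> 0 < a ->
     exists2 k, D k & F k (a *: x) <= a * F i x) ->
  exists q, [/\ sublinear q, (forall i x, D i -> q x <= F i x)
    & forall m x, (forall i, D i -> m <= F i x) -> m <= q x].
Proof.
move=> [i0 Di0] Flb FD FZ; pose q x := inf [set F i x | i in D]%classic.
have q_le i x : D i -> q x <= F i x.
  move=> Di; apply: ge_inf; last by exists i.
  by have [m mF] := Flb x; exists m => _ [j Dj <-]; exact: mF.
have le_q m x : (forall i, D i -> m <= F i x) -> m <= q x.
  move=> mF; apply: lb_le_inf; first by exists (F i0 x), i0.
  by move=> _ [j Dj <-]; exact: mF.
exists q; split => //; split => [x y|a x a0].
  rewrite -lerBlDr; apply/le_q => i Di; rewrite lerBlDr -lerBlDl.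
  apply/le_q => j Dj; rewrite lerBlDl.
  have [k Dk] := FD i j x y Di Dj; apply: le_trans; exact: q_le.
rewrite -ler_pdivrMl //; apply/le_q => i Di; rewrite ler_pdivrMl //.
have [k Dk] := FZ i a x Di a0; apply: le_trans; exact: q_le.
Qed.

(** Take the infimum over [t >= 0] of [p (x + t *: x0) - t * p x0]: [t = 0] gives [q <= p], and
    [t = 1] gives the bound at [- x0]. *)
Lemma sublinear_tilt p x0 : sublinear p ->
  exists q, [/\ sublinear q, forall x, q x <= p x & q (- x0) <= - p x0].
Proof.
move=> ps; pose F (t : R) x := p (x + t *: x0) - t * p x0.
have [|x|s t x y s0 t0|t a x t0 a0|q [qs qF _]] :=
    @inf_sublinear R [set t | 0 <= t]%classic F.
- by exists 0 => /=.
- exists (- p (- x)) => t t0; rewrite /F -(sublinearZ _ ps t0).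
  have := ps.1 (- x) (x + t *: x0); rewrite addKr; lra.
- exists (s + t); first exact: addr_ge0.
  rewrite /F scalerDl addrACA.
  have := ps.1 (x + s *: x0) (y + t *: x0); lra.
- exists (a * t); first exact: mulr_ge0 (ltW a0) t0.
  have := ps.2 a (x + t *: x0) a0; rewrite /F scalerDr scalerA; lra.
exists q; split => // [x|].
  by have /= := qF 0 x (lexx 0); rewrite /F scale0r addr0 mul0r subr0.
have /= := qF 1 (- x0) ler01.
by rewrite /F scale1r addNr sublinear0 // mul1r sub0r.
Qed.

(* A minimal sublinear functional coincides with each of its tilts, hence is
   odd, hence is linear. *)
Lemma sublinear_dominates_linear p : sublinear p ->
  exists2 f : V -> R^o, linear f & forall x, (f x : R) <= p x.
Proof.
move=> ps; pose T := {q | sublinear q /\ forall x, q x <= p x}.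
(* The order is reversed, so a maximal element is a pointwise minimal functional. *)
pose rel (s t : T) := `[< forall x, sval t x <= sval s x >].
have [|s t r||A A_tot|[q [qs qp]] q_min] := @Zorn T rel.
- by move=> s; apply/asboolP.
- move=> /asboolP st /asboolP tr; apply/asboolP => x.
  exact: le_trans (tr x) (st x).
- move=> [s sP] [t tP] /asboolP /= st /asboolP /= ts; apply/eq_exist/funext => x.
  by apply/eqP; rewrite eq_le ts st.
(* A nonempty chain is bounded by its pointwise infimum, finite because [- p (- x)] lies below; the
   empty chain is bounded by [p]. *)
- have [[t0 At0]|A0] := pselect (A !=set0)%classic; last first.
    exists (exist _ p (conj ps (fun x => lexx (p x)))) => s As.
    by case: A0; exists s.
  have [|x|s t x y As At|s a x As a0|q [qs qF _]] :=
      @inf_sublinear T A (fun s => sval s).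
  + by exists t0.
  + exists (- p (- x)) => -[s [ss sp]] _ /=.
    by apply: le_trans (sublinear_geN x ss); rewrite lerN2.
  + have [/asboolP st|/asboolP ts] := A_tot _ _ As At.
      exists t => //; apply: le_trans ((svalP t).1.1 _ _) _.
      by rewrite lerD2r st.
    exists s => //; apply: le_trans ((svalP s).1.1 _ _) _.
    by rewrite lerD2l ts.
  + by exists s => //; exact: (svalP s).1.2.
  have qp x : q x <= p x by apply: le_trans (qF t0 x At0) _; exact: (svalP t0).2.
  by exists (exist _ q (conj qs qp)) => s As; apply/asboolP => x /=; exact: qF.
have qN x : q (- x) = - q x.
  have [r [rs rq rx]] := sublinear_tilt x qs.
  have rp y : r y <= p y by exact: le_trans (rq y) (qp y).
  have /(congr1 sval) /= rE := q_min (exist _ r (conj rs rp)) (asboolT rq).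
  apply/eqP; rewrite eq_le -{1}rE rx /=.
  by have := sublinear_geN (- x) qs; rewrite opprK.
have qD x y : q (x + y) = q x + q y.
  apply/eqP; rewrite eq_le qs.1 /=.
  have := qs.1 (- x) (- y); rewrite -opprD !qN; lra.
exists q => // a x y; rewrite qD; congr (_ + _).
have [a0|/ltW a0] := leP 0 a; first exact: sublinearZ.
rewrite -[a *: x]opprK -scaleNr qN sublinearZ ?oppr_ge0 //.
by rewrite mulNr opprK.
Qed.

End Sublinear.

(** * Constructing functionals in order intervals of the dual *)

Section Duality.
Context (R : realType) (E : rieszType R).
Implicit Types (phi psi : odual E).

Lemma odual_ge0 phi x : 0 <= phi -> 0 <= x -> 0 <= (phi x : R).
Proof. by move=> /odual_lerP phi0 /phi0. Qed.

Lemma odual_le phi x y : 0 <= phi -> x <= y -> (phi x : R) <= phi y.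
Proof.
move=> phi0 xy; rewrite -subr_ge0 -[_ - _](linearB phi).
by apply: odual_ge0; rewrite ?riesz_subr_ge0.
Qed.

(** For [x >= 0] the bound by [phi (rpos _)] gives positivity when read at [- x], where it vanishes,
    and [psi <= phi] when read at [x]. *)
Lemma hahn_banach_odual phi (p : E -> R) : 0 <= phi -> sublinear p ->
  (forall x, p x <= phi (rpos x)) ->
  exists psi, [/\ 0 <= psi, psi <= phi & forall x, (psi x : R) <= p x].
Proof.
move=> phi0 ps p_le; have [f f_lin fp] := sublinear_dominates_linear ps.
have fB x y : (f (x - y) : R) = f x - f y.
  by rewrite addrC -scaleN1r f_lin addrC; congr (_ + _); exact: mulN1r.
have f0 : f 0 = 0 :> R by have := fB 0 0; rewrite !subrr.
have f_ge0 x : 0 <= x -> 0 <= (f x : R).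
  move=> x0; have rN : rpos (- x) = 0.
    apply/eqP; rewrite eq_le rpos_ge0 andbT rsup_le lexx andbT.
    by rewrite -oppr0 riesz_lerN2.
  have := le_trans (fp (- x)) (p_le (- x)); have := fB 0 x.
  by rewrite rN linear0 !sub0r f0 => ->; rewrite sub0r oppr_le0.
have f_le x y : x <= y -> (f x : R) <= f y.
  by move=> xy; rewrite -subr_ge0 -fB f_ge0 // riesz_subr_ge0.
have f_bd : order_bounded f.
  by move=> a b; exists (f a), (f b) => x /andP[ax xb]; rewrite !f_le.
exists (mk_obop f_lin f_bd : odual E); split => //; apply/odual_lerP => x x0.
  exact: f_ge0.
by rewrite -{2}(rpos_id x0); exact: le_trans (fp x) (p_le x).
Qed.

Lemma odual_rpos_sublinear phi : 0 <= phi ->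
  sublinear (fun x => phi (rpos x) : R).
Proof.
move=> phi0; split => [x y|a x a0].
  rewrite -[leRHS](linearD phi); exact: odual_le (rposD x y).
by rewrite rposZ // linearZ.
Qed.

(** Tilting [phi (rpos _)] along [u - v] gives [psi u - psi v >= phi u]; since [psi u <= phi u] and
    [psi v >= 0], both are equalities. *)
Lemma odual_component phi u v : 0 <= phi -> 0 <= u -> 0 <= v -> rinf u v = 0 ->
  exists psi, [/\ 0 <= psi, psi <= phi, psi u = phi u & psi v = 0].
Proof.
move=> phi0 u0 v0 uv.
have [q [qs q_le qx]] := sublinear_tilt (u - v) (odual_rpos_sublinear phi0).
have [psi [psi0 psi_le psiq]] := hahn_banach_odual phi0 qs q_le.
have := le_trans (psiq _) qx; rewrite rpos_disjB // linearN linearB /=.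
have := odual_ge0 psi0 v0; move/odual_lerP: (psi_le) => /(_ u u0) psi_u psi_v psi_uv.
have psi_uE : psi u = phi u :> R by move: psi_u psi_v psi_uv; lra.
by exists psi; split => //; move: psi_u psi_v psi_uv; lra.
Qed.

(* The infimum over [0 <= g <= h] of [A g + B (h - g)] is additive in [h], so it
   defines a functional below [A] and [B], that is, below 0. *)
Lemma odual_inf_approx (A B : odual E) (h : E) (e : R) : 0 <= A -> 0 <= B ->
  rinf A B = 0 -> 0 <= h -> 0 < e ->
  exists g, [/\ 0 <= g, g <= h & (A g + B (h - g) : R) < e].
Proof.
move=> A0 B0 AB h0 e0.
pose V h := [set (A g + B (h - g) : R)
  | g in [set g : E | 0 <= g <= h]]%classic.
pose q h : R := inf (V h).
have V_neq0 k : 0 <= k -> (V k !=set0)%classic.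
  by move=> k0; exists (A k + B (k - k) : R), k => //=; rewrite k0 lexx.
have V_ge0 k g : 0 <= g -> g <= k -> 0 <= (A g + B (k - g) : R).
  by move=> g0 gk; rewrite addr_ge0 // odual_ge0 // riesz_subr_ge0.
have q_le k g : 0 <= g -> g <= k -> q k <= (A g + B (k - g) : R).
  move=> g0 gk; apply: ge_inf; last by exists g => //=; rewrite g0 gk.
  by exists 0 => _ [g' /= /andP[g'0 g'k] <-]; exact: V_ge0.
have le_q k (m : R) : 0 <= k ->
    (forall g, 0 <= g -> g <= k -> m <= (A g + B (k - g) : R)) -> m <= q k.
  move=> k0 mV; apply: lb_le_inf; first exact: V_neq0.
  by move=> _ [g /= /andP[g0 gk] <-]; exact: mV.
have VD x y g g' : (A (g + g') + B (x + y - (g + g')) : R) =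
    (A g + B (x - g)) + (A g' + B (y - g')).
  by rewrite opprD addrACA !linearD addrACA.
have qD x y : 0 <= x -> 0 <= y -> q (x + y) = q x + q y.
  move=> x0 y0; apply/eqP; rewrite eq_le; apply/andP; split.
    rewrite -lerBlDr; apply/le_q => // g g0 gx; rewrite lerBlDr -lerBlDl.
    apply/le_q => // g' g'0 g'y; rewrite lerBlDl -VD.
    by apply: q_le; [exact: riesz_addr_ge0|exact: riesz_lerD2].
  apply/le_q; first exact: riesz_addr_ge0.
  move=> g g0 gxy.
  have [g1 [g2 [-> /andP[g10 g1x] /andP[g20 g2y]]]] := riesz_split x0 y0 g0 gxy.
  by rewrite VD lerD ?q_le.
have qZ_le (a : R) x : 0 < a -> 0 <= x -> q (a *: x) <= a * q x.
  move=> a0 x0; rewrite -ler_pdivrMl //; apply/le_q => // g g0 gx.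
  rewrite ler_pdivrMl // mulrDr -[a * A g](linearZ_LR A) -[a * B _](linearZ_LR B).
  rewrite scalerBr; apply: q_le; first exact: riesz_scaler_ge0 (ltW a0) g0.
  exact: riesz_scaler_le (ltW a0) gx.
have qZ (a : R) x : 0 < a -> 0 <= x -> q (a *: x) = a * q x.
  move=> a0 x0; apply/eqP; rewrite eq_le qZ_le //= -ler_pdivlMl //.
  rewrite -{1}[x](scalerK (lt0r_neq0 a0)) qZ_le ?invr_gt0 //.
  exact: riesz_scaler_ge0 (ltW a0) x0.
have [|D DE] := @cone_extension R E R^o q _ qD qZ.
  by move=> x x0; apply/le_q => // g; exact: V_ge0.
(* The choices [g = x] and [g = 0] in the infimum give [D <= A] and [D <= B]. *)
have D_le0 : (D : odual E) <= 0.
  apply: (rinf_eq0_le AB); apply/odual_lerP => x x0; rewrite DE //.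
    by have := q_le x x x0 (lexx x); rewrite subrr linear0 addr0.
  by have := q_le x 0 (lexx 0) x0; rewrite subr0 linear0 add0r.
have : q h < e.
  by apply: le_lt_trans e0; rewrite -DE //; move/odual_lerP: D_le0; exact.
case/(inf_lt (V_neq0 h h0)) => _ [g /= /andP[g0 gh] <-] ge.
by exists g.
Qed.

End Duality.

(** * The canonical map into the bidual is a Riesz homomorphism *)

Section BidualEmbedding.
Context (R : realType) (E : rieszType R).

Lemma bidual_eval_linear : linear (@bidual_eval R E).
Proof. by move=> a x y; apply: obopP => f; rewrite /= linearP. Qed.

HB.instance Definition _ :=
  GRing.isLinear.Build R E (odual (odual E)) *:%R (@bidual_eval R E)
    bidual_eval_linear.

Lemma bidual_eval_ge0 (x : E) : 0 <= x -> 0 <= bidual_eval x.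
Proof. by move=> x0; apply/odual_lerP => f f0; exact: (@odual_ge0 _ _ f). Qed.

(** Split a positive [f] into [g], which vanishes at [y], and [f - g], which vanishes at [x]; a
    common lower bound is at most 0 on each piece. *)
Lemma bidual_eval_disj (x y : E) : 0 <= x -> 0 <= y -> rinf x y = 0 ->
  rinf (bidual_eval x) (bidual_eval y) = 0.
Proof.
move=> x0 y0 xy; apply: rinf_eq0; rewrite ?bidual_eval_ge0 // => z _ zx zy.
apply/odual_lerP => f f0; rewrite odual0E.
have [g [g0 gf gx gy]] := odual_component f0 x0 y0 xy.
have fg0 : 0 <= f - g by rewrite riesz_subr_ge0.
have -> : z f = z g + z (f - g) :> R by rewrite linearB addrC subrK.
have /odual_lerP/(_ _ fg0) := zx; have /odual_lerP/(_ _ g0) := zy.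
rewrite !bidual_evalE odualDE odualNE gx gy; lra.
Qed.

Lemma bidual_eval_rabs (x : E) : bidual_eval (rabs x) = rabs (bidual_eval x).
Proof.
exact: riesz_hom_rabs bidual_eval_ge0 bidual_eval_disj x.
Qed.

Lemma bidual_eval_disjoint (x y : E) : disjoint_vec x y ->
  disjoint_vec (bidual_eval x) (bidual_eval y).
Proof.
by move=> xy; rewrite /disjoint_vec -!bidual_eval_rabs bidual_eval_disj ?rabs_ge0.
Qed.

Lemma bidual_eval_disjoint_inj (x y : E) : injective (@bidual_eval R E) ->
  disjoint_vec (bidual_eval x) (bidual_eval y) -> disjoint_vec x y.
Proof.
move=> J_inj; rewrite /disjoint_vec -!bidual_eval_rabs => xy.
have w0 : 0 <= rinf (rabs x) (rabs y) by rewrite rinf_ge0 ?rabs_ge0.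
apply: J_inj; rewrite linear0; apply/eqP; rewrite eq_le bidual_eval_ge0 // andbT.
by apply: (rinf_eq0_le xy); apply: pos_op_le bidual_eval_ge0 _ _ _;
  [exact: rinf_lel|exact: rinf_ler].
Qed.

End BidualEmbedding.

(** * The second adjoint of a Riesz homomorphism *)

Section RieszHomAdjoint.
Context (R : realType) (E F : rieszType R) (S : obop E F).
Hypothesis S_ge0 : forall x, 0 <= x -> 0 <= S x.
Hypothesis S_disj : forall x y, 0 <= x -> 0 <= y -> rinf x y = 0 ->
  rinf (S x) (S y) = 0.

Lemma oadjoint_ge0 (phi : odual F) : 0 <= phi -> 0 <= oadjoint S phi.
Proof.
move=> phi0; apply/odual_lerP => x x0; rewrite oadjointE.
by apply: odual_ge0 => //; exact: S_ge0.
Qed.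

(* [psi] is any linear functional below
   [p y = inf_x (g x + phi ((y - S x)^+))], as [p (S x) <= g x]. *)
Lemma oadjoint_interval (phi : odual F) (g : odual E) : 0 <= phi ->
  0 <= g -> g <= oadjoint S phi ->
  exists psi : odual F, [/\ 0 <= psi, psi <= phi & oadjoint S psi = g].
Proof.
move=> phi0 g0 g_le; pose G x y : R := (g x : R) + phi (rpos (y - S x)).
have [phiD phiZ] := odual_rpos_sublinear phi0.
(* Keeps the infimum of [G] finite. [S] commutes with [rpos], so [phi (rpos (- S x))] is the adjoint
   of [phi] at [rpos (- x)], which dominates [g (- x)]. *)
have g_ge x : - (phi (rpos (- S x)) : R) <= g x.
  rewrite -linearN -(riesz_hom_rpos S_ge0 S_disj).
  have := odual_le g0 (rpos_ge (- x)); rewrite linearN /=.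
  move/odual_lerP: g_le => /(_ _ (rpos_ge0 (- x))); rewrite oadjointE; lra.
have [|y|x1 x2 y1 y2 _ _|x a y _ a0|p [ps pG _]] := @inf_sublinear R F E setT G.
- by exists 0.
- exists (- (phi (rpos (- y)) : R)) => x _; rewrite /G.
  have := phiD (y - S x) (- y); have := g_ge x; rewrite addrAC subrr sub0r; lra.
- exists (x1 + x2) => //; rewrite /G (linearD g) (linearD S) /= opprD addrACA.
  have := phiD (y1 - S x1) (y2 - S x2) ; lra.
- exists (a *: x) => //; rewrite /G (linearZ_LR S) (linearZ_LR g) /= -scalerBr.
  have := phiZ a (y - S x) a0; rewrite mulrDr lerD2l; exact.
have p_le y : p y <= phi (rpos y).
  by apply: le_trans (pG 0 y I) _; rewrite /G (linear0 g) (linear0 S) subr0 add0r.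
have [psi [psi0 psi_le psip]] := hahn_banach_odual phi0 ps p_le.
have psi_S x : (psi (S x) : R) <= g x.
  apply: le_trans (psip (S x)) _; apply: le_trans (pG x _ I) _.
  by rewrite /G subrr rpos_id // linear0 addr0.
(* An inequality between linear functionals on the whole space is an equality, by evaluating at
   [- x]. *)
exists psi; split => //; apply: obopP => x; rewrite oadjointE.
apply/eqP; rewrite eq_le psi_S /=.
by have := psi_S (- x); rewrite !linearN lerN2.
Qed.

(** Split the adjoint of [phi] into pieces on which [A] and [B] are small, and lift this to
    [phi = psi + (phi - psi)]. A common lower bound is then below every [e > 0] at [phi]. *)
Lemma oadjoint2_disj (A B : odual (odual E)) : 0 <= A -> 0 <= B ->
  rinf A B = 0 ->
  rinf (oadjoint (oadjoint S) A) (oadjoint (oadjoint S) B) = 0.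
Proof.
move=> A0 B0 AB; apply: rinf_eq0.
- by apply/odual_lerP => f /oadjoint_ge0; exact: odual_ge0.
- by apply/odual_lerP => f /oadjoint_ge0; exact: odual_ge0.
move=> D _ DA DB; apply/odual_lerP => phi phi0; rewrite odual0E.
apply/ler_addgt0Pr => e e0; rewrite add0r.
have [g [g0 g_le ABg]] := odual_inf_approx A0 B0 AB (oadjoint_ge0 phi0) e0.
have [psi [psi0 psi_le psig]] := oadjoint_interval phi0 g0 g_le.
have phipsi0 : 0 <= phi - psi by rewrite riesz_subr_ge0.
have -> : D phi = D psi + D (phi - psi) :> R by rewrite linearB addrC subrK.
apply: le_trans (ltW ABg); apply: lerD.
  by move/odual_lerP: DA => /(_ psi psi0); rewrite oadjointE psig.
by rewrite -psig -linearB; move/odual_lerP: DB; exact.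
Qed.

End RieszHomAdjoint.

(** * Domination of second adjoints, and the three statements *)

Lemma odual_dominated (R : realType) (E : rieszType R) (A : odual (odual E))
  (f h : odual E) : rabs f <= h -> (A f : R) <= rabs A h.
Proof.
move=> fh; have A0 := rabs_ge0 A.
apply: le_trans (odual_le A0 fh); rewrite (rabsE f) -{1}[f]rposBN linearB linearD.
apply: lerD.
  by move/odual_lerP: (rsup_gel A (- A)) => /(_ _ (rpos_ge0 f)).
by move/odual_lerP: (rsup_ger A (- A)) => /(_ _ (rpos_ge0 (- f))).
Qed.

Lemma oadjoint2_dominated (R : realType) (E F : rieszType R) (T S : obop E F) :
  (forall x, 0 <= x -> rabs (T x) <= S x) ->
  forall A, rabs (oadjoint (oadjoint T) A) <= oadjoint (oadjoint S) (rabs A).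
Proof.
move=> TS A.
have T_le (phi : odual F) : 0 <= phi -> rabs (oadjoint T phi) <= oadjoint S phi.
  move=> phi0; rewrite rabs_le; apply/andP; split; apply/odual_lerP => x x0.
    rewrite !oadjointE; apply: odual_le => //; apply: le_trans (TS x x0).
    exact: rsup_gel.
  rewrite odualNE !oadjointE -linearN; apply: odual_le => //.
  by apply: le_trans (TS x x0); exact: rsup_ger.
rewrite rabs_le; apply/andP; split; apply/odual_lerP => phi phi0.
  by rewrite !oadjointE; apply: odual_dominated; exact: T_le.
rewrite odualNE !oadjointE -linearN; apply: odual_dominated.
by rewrite rabsN; exact: T_le.
Qed.

Lemma oadjoint2_bidual_eval (R : realType) (E F : rieszType R) (T : obop E F)
  (x : E) : oadjoint (oadjoint T) (bidual_eval x) = bidual_eval (T x).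
Proof. exact: obopP. Qed.

Lemma bidual_eval_inj (R : realType) (F : rieszType R) :
  odual_separates_points F -> injective (@bidual_eval R F).
Proof.
move=> F_sep x y xy; apply: contrapT => /F_sep[f]; apply.
by rewrite -(bidual_evalE x) xy.
Qed.

Theorem theorem2p1 (R : realType) (E F : rieszType R) (T : obop E F) :
  (archimedean_riesz F -> disjointness_preserving T ->
     disjointness_preserving (oadjoint (oadjoint T)))
  /\
  (bijective (@bidual_eval R E) -> disjointness_preserving T ->
     disjointness_preserving (oadjoint (oadjoint T)))
  /\
  (odual_separates_points F ->
     disjointness_preserving (oadjoint (oadjoint T)) ->
     disjointness_preserving T).
Proof.
split=> [F_arch T_disj A B AB|]; last split.
- have [S S_E] := disjointness_preserving_modulus F_arch T_disj.
  have S_ge0 x : 0 <= x -> 0 <= S x by move=> /S_E->; exact: rabs_ge0.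
  have S_disj x y : 0 <= x -> 0 <= y -> rinf x y = 0 -> rinf (S x) (S y) = 0.
    move=> x0 y0 xy; rewrite !S_E //; apply: T_disj.
    by rewrite disjoint_vec_pos.
  have TS x : 0 <= x -> rabs (T x) <= S x by move=> /S_E->.
  have dom := oadjoint2_dominated TS.
  (* The moduli of the images of [A] and [B] lie below the images of [rabs A] and [rabs B] under the
     second adjoint of [S], which are disjoint. *)
  apply: (rinf_eq0S (oadjoint2_disj S_ge0 S_disj _ _ AB));
    by rewrite ?rabs_ge0 ?dom.
(* By surjectivity [A] and [B] are evaluations; injectivity brings disjointness down to [E], and the
   embedding of [F] carries it back up. *)
- move=> J_bij T_disj A B; have [K _ JK] := J_bij.
  rewrite -(JK A) -(JK B) !oadjoint2_bidual_eval => AB.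
  apply/bidual_eval_disjoint/T_disj.
  by apply: bidual_eval_disjoint_inj AB; exact: bij_inj.
(* Disjointness passes up to the bidual of [E], across by the second adjoint, and down to [F] by
   injectivity of its embedding. *)
- move=> F_sep T_disj x y /bidual_eval_disjoint /T_disj.
  rewrite !oadjoint2_bidual_eval; apply: bidual_eval_disjoint_inj.
  exact: bidual_eval_inj.
Qed.
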